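(* Fix a positive integer $k$ and a prime power $q$, let $n=q^k-1$, and fix any linear order on $\mathbb{F}_q$. (i) Every nonzero codeword $w$ of a $k$-dimensional dual Hamming code $\mathcal{C}\subseteq\mathbb{F}_q^n$ has $\mathrm{cdes}(w)=\frac{q-1}{2}\cdot q^{k-1}$. (ii) If $q\in\{2,3\}$, then a monic irreducible polynomial $g^\perp(x)\in\mathbb{F}_q[x]$ of degree $k$ dividing $x^n-1$ is primitive if and only if the word $w\in\mathbb{F}_q^n$ corresponding to $g(x)=\frac{x^n-1}{g^\perp(x)}$ has $\mathrm{cdes}(w)=\frac{q-1}{2}\cdot q^{k-1}$. (iii) If $q\in\{2,3\}$, then $(X,X^{\mathrm{maj}}(t),C)$ exhibits the cyclic sieving phenomenon for $X=\mathcal{C}$ any $k$-dimensional dual Hamming code in $\mathbb{F}_q^n$. (iv) If $q=2$ (with $0<1$), then $(X,X^{\mathrm{inv}}(t),C)$ exhibits the cyclic sieving phenomenon for $X=\mathcal{C}$ any $k$-dimensional dual Hamming code in $\mathbb{F}_2^n$.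
   Context: Words are identified with polynomials via $(w_1,\ldots,w_n)\mapsto w_1+w_2x+\cdots+w_nx^{n-1}\in\mathbb{F}_q[x]/(x^n-1)$. A polynomial $f\in\mathbb{F}_q[x]$ of degree $k$ is primitive if it is irreducible and the image of $x$ has multiplicative order $q^k-1$ in $\mathbb{F}_q[x]/(f)$. A $k$-dimensional dual Hamming code of length $n=q^k-1$ is the ideal of $\mathbb{F}_q[x]/(x^n-1)$ (viewed as a subset of $\mathbb{F}_q^n$) generated by $(x^n-1)/g^\perp(x)$ with $g^\perp$ monic primitive of degree $k$. $C=\langle c\rangle\cong\mathbb{Z}/n\mathbb{Z}$ acts by cyclic shift $c(w_1,\ldots,w_n)=(w_2,\ldots,w_n,w_1)$. Statistics: $\mathrm{maj}(w)=\sum_{1\le i\le n-1,\ w_i>w_{i+1}}i$; $\mathrm{inv}(w)=\#\{(i,j):i<j,\ w_i>w_j\}$; $\mathrm{cdes}(w)=\#\{1\le i\le n: w_i>w_{i+1}\}$ with $w_{n+1}:=w_1$. $X^{\mathrm{stat}}(t)=\sum_{x\in X}t^{\mathrm{stat}(x)}$. A triple $(X,X(t),C)$ exhibits the cyclic sieving phenomenon if for all integers $d$, $\#\{x\in X:c^d(x)=x\}=X(e^{2\pi i d/n})$.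
   Formalization: Parts (i) and (ii) are proved for k ≥ 2 or q = 3; for k = 1 and q ≠ 3 they fail (q = 2, k = 1: the word (1) has cdes 0, not 1/2; q ≥ 4, k = 1: some linear order gives cdes 1). *)

(* Defs.v *)
From HB Require Import structures.
From mathcomp Require Import all_boot all_order all_fingroup all_algebra.
From mathcomp Require Import all_field.
From mathcomp Require Import wochoice reals trigo complex.

Set Implicit Arguments.
Unset Strict Implicit.
Unset Printing Implicit Defensive.

Import Order.TTheory GRing.Theory Num.Theory.

Local Open Scope ring_scope.

(* [primitive_poly] is stated in the library through divisibility of the
   polynomials 'X^i - 1; this is the reading through the multiplicative order
   of the image of 'X in the quotient ring. *)
Lemma primitive_poly_orderP (F : finFieldType) (f : {poly F}) :
  primitive_poly f <->
  [/\ f \is monic, irreducible_poly f &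
      (#|F| ^ (size f).-1 - 1).-primitive_root ('qX : {poly %/ f})].
Proof.
have key (fM : f \is monic) (sf : (1 < size f)%N) i :
    (('qX : {poly %/ f}) ^+ i == 1) = (f %| 'X^i - 1).
  have -> : ('qX : {poly %/ f}) ^+ i = in_qpoly f 'X^i by rewrite rmorphXn.
  rewrite -subr_eq0 -(rmorph1 (in_qpoly f)) -rmorphB /=.
  by rewrite -val_eqE /= /mk_monic fM sf -Pdiv.IdomainMonic.modpE.
have cardE (fM : f \is monic) (sf : (1 < size f)%N) :
    #|{poly %/ f}|.-1 = (#|F| ^ (size f).-1 - 1)%N.
  by rewrite card_monic_qpoly // subn1.
have pos (sf : (1 < size f)%N) : (0 < #|F| ^ (size f).-1 - 1)%N.
  by rewrite subn_gt0 -(exp1n (size f).-1) ltn_exp2r ?finNzRing_gt1 //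
     -subn1 subn_gt0.
split=> [/primitive_polyP /= [[fI fM] fd fN]|[fM fI prim]].
  have sf := fI.1; split=> //.
  rewrite (cardE fM sf) in fd fN.
  apply/andP; split; first exact: pos.
  apply/forallP => i; rewrite unity_rootE key //; apply/eqP.
  have := ltn_ord i; rewrite leq_eqVlt => /orP[/eqP->|lti].
    by rewrite fd eqxx.
  by rewrite (negbTE (fN _ _)) //; apply/esym/negbTE; rewrite neq_ltn lti.
have sf := fI.1; apply/primitive_polyP; rewrite /= (cardE fM sf).
split=> //; first by rewrite -key // (prim_expr_order prim).
move=> i /andP[i0 ilt]; rewrite -key // -(prim_order_dvd prim).
by apply/negP => /(dvdn_leq i0); rewrite leqNgt ilt.
Qed.

Section Statistics.
Variables (F : finFieldType) (le : rel F) (n : nat).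
Implicit Type w : 'rV[F]_n.

Definition gt_of (x y : F) : bool := le y x && (x != y).

(* The entry [w 0 i], with i counted from 0, is the letter of index i + 1 of
   the word; [ordS] is the successor modulo n. *)
Definition word_maj w : nat :=
  (\sum_(i < n | (i.+1 < n) && gt_of (w 0%R i) (w 0%R (ordS i)))
     i.+1)%N.

Definition word_inv w : nat :=
  #|[set p : 'I_n * 'I_n | (p.1 < p.2)%N && gt_of (w 0 p.1) (w 0 p.2)]|.

Definition word_cdes w : nat := #|[set i : 'I_n | gt_of (w 0 i) (w 0 (ordS i))]|.

End Statistics.

Arguments word_maj {F} le {n} w.
Arguments word_inv {F} le {n} w.
Arguments word_cdes {F} le {n} w.

Section CyclicShift.
Variables (F : finFieldType) (n : nat).

Definition cshift_fun (w : 'rV[F]_n) : 'rV[F]_n := \row_i w 0 (ordS i).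

Lemma cshift_fun_inj : injective cshift_fun.
Proof.
move=> u v /rowP uv; apply/rowP => i.
by have := uv (ord_pred i); rewrite !mxE ord_predK.
Qed.

Definition cshift : {perm 'rV[F]_n} := perm cshift_fun_inj.

End CyclicShift.

Definition permz (T : finType) (c : {perm T}) (d : int) : {perm T} :=
  match d with
  | Posz m => (c ^+ m)%g
  | Negz m => (c ^- m.+1)%g
  end.

Definition genfun (T : finType) (X : {set T}) (stat : T -> nat) : {poly int} :=
  \sum_(x in X) 'X^(stat x).

Definition expi (R : realType) (theta : R) : R[i] :=
  (cos theta +i* sin theta)%C.

Definition exhibits_csp (R : realType) (T : finType) (X : {set T})
    (P : {poly int}) (c : {perm T}) (n : nat) : Prop :=
  forall d : int,
    #|[set x in X | permz c d x == x]|%:R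
    = (map_poly intr P).[expi (2 * pi * d%:~R / n%:R : R)].

(* Ideal of F[x]/(x^n - 1) generated by g, as a set of words; [rVpoly] is
   w |-> w_1 + w_2 x + ... + w_n x^(n-1). For n > 0 the modulus is monic of
   positive degree, so {poly %/ 'X^n - 1} is the intended quotient. *)
Definition cyclic_code (F : finFieldType) (n : nat) (g : {poly F}) :
    {set 'rV[F]_n} :=
  [set w | [exists a : {poly %/ ('X^n - 1 : {poly F})},
              in_qpoly ('X^n - 1) (rVpoly w) == a * in_qpoly ('X^n - 1) g]].

(* [primitive_poly] includes monicity. *)
Definition dual_hamming_code (F : finFieldType) (k n : nat)
    (C : {set 'rV[F]_n}) : Prop :=
  n = (#|F| ^ k - 1)%N /\
  exists gperp : {poly F},
    [/\ primitive_poly gperp, size gperp = k.+1 &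
        C = cyclic_code n (('X^n - 1) %/ gperp)].

(* Main.v *)
Require Import Defs.
From HB Require Import structures.
From mathcomp Require Import all_boot all_order all_fingroup all_algebra.
From mathcomp Require Import all_field.
From mathcomp Require Import wochoice reals trigo complex.
From mathcomp Require Import ring lra zify.

(* When gperp is primitive, x acts freely on the n = q^k - 1 nonzero codewords,
   so they form a single orbit of the cyclic shift. Hence the pairs of cyclically
   adjacent letters of one nonzero word are the pairs of first two letters of all
   nonzero words; by linearity every pair of letters is taken by q^(k-2)
   codewords (k > 1), which gives cdes, and single letters give the weight.
   A shift changes maj by -cdes modulo n, and inv (for q = 2) by the weight.
   For q = 2, 3 both are powers of q, hence coprime to n, so that maj and inv
   run through all residues modulo n along the orbit: this is cyclic sieving.
   Conversely, if x^m = 1 modulo gperp, the word of g is fixed by m shifts, so n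
   divides m * cdes, hence m when cdes is coprime to n. *)

Set Implicit Arguments.
Unset Strict Implicit.
Unset Printing Implicit Defensive.

Import Order.TTheory GRing.Theory Num.Theory.

Local Open Scope ring_scope.

(** * Complex roots of unity written as [expi] *)

Section Expi.
Variable R : realType.
Implicit Types x y : R.

Lemma expi0 : expi (0 : R) = 1.
Proof. by rewrite /expi cos0 sin0. Qed.

Lemma expiD x y : expi (x + y) = expi x * expi y.
Proof.
by apply/eqP; rewrite eq_complex /= cosD sinD eqxx (addrC (sin x * cos y)) eqxx.
Qed.

Lemma expiMn x m : expi (x *+ m) = expi x ^+ m.
Proof. by elim: m => [|m IH]; rewrite ?expi0 // mulrS exprS expiD IH. Qed.

Lemma expi2pi : expi (2 * pi : R) = 1.
Proof. by rewrite mulr_natl /expi cos2pi sin2pi. Qed.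

Lemma expi2piMz (m : int) : expi (2 * pi * m%:~R : R) = 1.
Proof.
case: m => m; first by rewrite mulr_natr expiMn expi2pi expr1n.
have e0 : expi (2 * pi * (Negz m)%:~R + 2 * pi *+ m.+1 : R) = 1.
  by rewrite NegzE mulrNz mulrN mulr_natr addNr expi0.
by rewrite expiD [X in _ * X]expiMn expi2pi expr1n mulr1 in e0.
Qed.

(** The value 1 would give [cos x = 1], hence [sin (x / 2) = 0] by the double angle formula, whereas
    [x / 2] lies strictly between 0 and [pi]. *)
Lemma expi_eq1_small x : 0 < x < 2 * pi -> expi x != 1.
Proof.
move=> /andP[x0 x2]; apply/negP => /eqP[cx _].
have sx : 0 < sin (x / 2).
  by apply: sin_gt0_pi; rewrite divr_gt0 //= ltr_pdivrMr // mulrC.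
have x2E : x / 2 *+ 2 = x by rewrite -[LHS]mulr_natr mulfVK ?pnatr_eq0.
have := cos_mulr2n (x / 2); rewrite x2E cx cos2sin2 => e.
have : sin (x / 2) ^+ 2 = 0 by lra.
by apply/eqP; rewrite expf_eq0 /= gt_eqF.
Qed.

Lemma expi_root (n : nat) (d : int) :
  (0 < n)%N -> expi (2 * pi * d%:~R / n%:R : R) ^+ n = 1.
Proof.
move=> n0; rewrite -expiMn -[_ *+ n]mulr_natr mulfVK ?expi2piMz //.
by rewrite pnatr_eq0 -lt0n.
Qed.

Lemma expi_root_eq1 (n : nat) (d : int) : (0 < n)%N ->
  (expi (2 * pi * d%:~R / n%:R : R) == 1) = (n %| `|d|)%N.
Proof.
move=> n0; have nR : n%:R != 0 :> R by rewrite pnatr_eq0 -lt0n.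
have nZ : n%:Z != 0 by rewrite -lt0n.
have -> : (n %| `|d|)%N = ((d %% n)%Z == 0).
  by rewrite -[LHS]/(n %| d)%Z; apply/dvdz_mod0P/eqP.
(* Full turns drop out, so [d] may be replaced by its remainder, for which the angle lies in a
   single turn. *)
have -> : expi (2 * pi * d%:~R / n%:R : R)
          = expi (2 * pi * (d %% n)%Z%:~R / n%:R).
  rewrite [in LHS](divz_eq d n) rmorphD rmorphM /= mulrDr mulrDl expiD.
  by rewrite mulrA (mulfK (nR : n%:~R != 0)) expi2piMz mul1r.
have [->|r0] := eqVneq (d %% n)%Z 0; first by rewrite mulr0 mul0r expi0 eqxx.
apply/negbTE/expi_eq1_small.
have rpos : (0 : R) < (d %% n)%Z%:~R by rewrite ltr0z lt_def r0 modz_ge0.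
have rlt : (d %% n)%Z%:~R < n%:R :> R.
  by rewrite -[n%:R]/(n%:Z%:~R) ltr_int ltz_pmod.
have p0 : (0 : R) < 2 * pi by rewrite mulr_gt0 // pi_gt0.
rewrite divr_gt0 ?mulr_gt0 ?ltr0n ?pi_gt0 //=.
by rewrite ltr_pdivrMr ?ltr0n // ltr_pM2l.
Qed.

End Expi.

(** * The cyclic shift and its effect on maj and cdes *)

Section CyclicShift.
Variables (F : finFieldType) (n : nat).
Implicit Types (u v w : 'rV[F]_n) (le : rel F).

Let c := cshift F n.

Lemma cshiftE u i : c u 0 i = u 0 (ordS i).
Proof. by rewrite permE mxE. Qed.

Lemma cshiftXE m u i : (c ^+ m)%g u 0 i = u 0 (iter m (@ordS n) i).
Proof.
by elim: m u i => [|m IH] u i; rewrite ?perm1 // expgS permM IH cshiftE.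
Qed.

Lemma cshiftX0 m : (c ^+ m)%g 0 = 0.
Proof. by apply/rowP => i; rewrite cshiftXE !mxE. Qed.

Lemma iter_ordS m (i : 'I_n) : iter m (@ordS n) i = ((i + m) %% n)%N :> nat.
Proof.
elim: m => [|m IH] /=; first by rewrite addn0 modn_small.
by rewrite IH -addn1 modnDml addn1 addnS.
Qed.

Lemma iter_ordS0 (i j : 'I_n) : i = 0%N :> nat -> iter j (@ordS n) i = j.
Proof. by move=> i0; apply: ord_inj; rewrite iter_ordS i0 add0n modn_small. Qed.

(** A permutation and its inverse have the same fixed points, so the sign of [d] is irrelevant. *)
Lemma permz_cshift_fix (d : int) u :
  (permz c d u == u) = ((c ^+ `|d|)%g u == u).
Proof.
case: d => // m; rewrite -(inj_eq (@perm_inj _ (c ^+ m.+1)%g)) /=.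
by rewrite permKV eq_sym.
Qed.

(** If two of these shifts agree, the difference of their exponents is a period below [n], hence
    0. *)
Lemma cshift_orbit_inj w : (forall m, ((c ^+ m)%g w == w) = (n %| m)%N) ->
  injective (fun i : 'I_n => (c ^+ i)%g w).
Proof.
move=> wfix; have aux (i j : 'I_n) :
    (i <= j)%N -> (c ^+ i)%g w = (c ^+ j)%g w -> i = j.
  move=> ij /esym/eqP; rewrite -{1}(subnK ij) expgD permM.
  rewrite (inj_eq (@perm_inj _ _)) wfix => /dvdn_leq nle; apply: ord_inj.
  apply/eqP; rewrite eqn_leq ij /= -subn_eq0 -leqn0 leqNgt.
  apply/negP => /nle; rewrite leqNgt => /negP; apply.
  exact: leq_ltn_trans (leq_subr _ _) (ltn_ord j).
move=> i j; case/orP: (leq_total i j) => ij e; first exact: aux.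
exact/esym/aux.
Qed.

Lemma cshiftX_neq0 w i : w != 0 -> (c ^+ i)%g w != 0.
Proof.
move=> w0; apply: contraNneq w0 => e.
by rewrite -(inj_eq (@perm_inj _ (c ^+ i)%g)) e cshiftX0.
Qed.

(** Serves both statistics: the increment [s] is itself invariant under the shift, so increments add
    up. It is [n - 1] times cdes for maj and the weight for inv. *)
Lemma stat_cshiftX (stat s : 'rV[F]_n -> nat) :
    (forall u, stat (c u) = stat u + s u %[mod n])%N ->
    (forall u, s (c u) = s u) ->
  forall i u, (stat ((c ^+ i)%g u) = stat u + i * s u %[mod n])%N.
Proof.
move=> statc sc; elim=> [|i IH] u; first by rewrite perm1 mul0n addn0.
by rewrite expgS permM IH sc -modnDml statc modnDml -addnA -mulSn.
Qed.

Lemma word_cdes_cshift le u : word_cdes le (c u) = word_cdes le u.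
Proof.
rewrite /word_cdes -[RHS](on_card_preimset (onW_bij _ (@ordS_bij n))).
by apply: eq_card => i; rewrite !inE !cshiftE.
Qed.

(** A shift lowers the position of every cyclic descent by one; a descent at position 1 wraps around
    to position [n], which is 0 modulo [n]. *)
Lemma word_maj_cdes_cshift le u :
  (word_maj le (c u) + word_cdes le u = word_maj le u %[mod n])%N.
Proof.
pose D v i := gt_of le (v 0 i) (v 0 (ordS i)).
(* Modulo [n], maj is a sum over all cyclic descents: the only additional position is the last one,
   of weight [n]. *)
have maj_sum v : (word_maj le v = \sum_(i < n | D v i) i.+1 %[mod n])%N.
  rewrite [in RHS](bigID (fun i : 'I_n => (i.+1 < n)%N)) /= -modnDmr.
  have /eqP-> : (n %| \sum_(i < n | D v i && ~~ (i.+1 < n)) i.+1)%N.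
    apply: dvdn_sum => i /andP[_]; rewrite -leqNgt => ni.
    by have /eqP<- : n == i.+1 by rewrite eqn_leq ni ltn_ord.
  by rewrite addn0; congr (_ %% _)%N; apply: eq_bigl => i; rewrite andbC.
have cdes_sum : word_cdes le u = (\sum_(i < n | D u (ordS i)) 1)%N.
  rewrite /word_cdes -sum1_card (reindex (@ordS n)) /=; last first.
    exact/onW_bij/ordS_bij.
  by apply: eq_bigl => i; rewrite inE.
rewrite -modnDml maj_sum modnDml cdes_sum maj_sum.
rewrite (eq_bigl (fun i => D u (ordS i))) => [|i]; last by rewrite /D !cshiftE.
rewrite -big_split /= [in RHS](reindex (@ordS n)) /=; last first.
  exact/onW_bij/ordS_bij.
rewrite -modn_summ -[RHS]modn_summ; congr (_ %% _)%N.
by apply: eq_bigr => i _; rewrite addn1 -[in RHS]addn1 modnDml addn1.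
Qed.

(** The factor [n.-1] stands for -1 modulo [n], which keeps the progression in the naturals. *)
Lemma word_maj_cshiftX le u i : (0 < n)%N ->
  (word_maj le ((c ^+ i)%g u)
   = word_maj le u + i * (n.-1 * word_cdes le u) %[mod n])%N.
Proof.
move=> npos; apply: (stat_cshiftX (s := fun v => (n.-1 * word_cdes le v)%N))
  => [{}u|{}u]; last by rewrite word_cdes_cshift.
rewrite -modnDml -(word_maj_cdes_cshift _ u) modnDml -addnA -mulSn.
by rewrite prednK // addnC mulnC modnMDl.
Qed.

End CyclicShift.

(** * Cyclic sieving for a single free orbit together with 0 *)

Section Csp.
Variables (R : realType) (F : finFieldType) (n : nat).
Implicit Types (u v w : 'rV[F]_n).

Let c := cshift F n.

Lemma geometric_root_sum (z : R[i]) : z ^+ n = 1 -> z != 1 ->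
  \sum_(i < n) z ^+ i = 0.
Proof.
move=> zn z1; have /esym/eqP := subrX1 z n.
by rewrite zn subrr mulf_eq0 subr_eq0 (negbTE z1) => /eqP.
Qed.

(* One orbit of nonzero words, along which [stat] is an arithmetic progression
   modulo n of step coprime to n, contributes a full set of residues mod n. *)
Lemma orbit_exhibits_csp (X : {set 'rV[F]_n}) w (stat : 'rV[F]_n -> nat)
    (s : nat) :
    (0 < n)%N -> w != 0 ->
    (forall m, ((c ^+ m)%g w == w) = (n %| m)%N) ->
    X = 0 |: [set (c ^+ i)%g w | i : 'I_n] ->
    stat 0 = 0%N ->
    (forall i, stat ((c ^+ i)%g w) = stat w + i * s %[mod n])%N ->
    coprime s n ->
  exhibits_csp R X (genfun X stat) c n.
Proof.
move=> npos w0 wfix XE stat0 statc cop d.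
set z := expi _.
have zn : z ^+ n = 1 by apply: expi_root.
have z1 : (z == 1) = (n %| `|d|)%N by apply: expi_root_eq1.
have zmod a b : (a = b %[mod n])%N -> z ^+ a = z ^+ b.
  by move=> ab; rewrite -(expr_mod a zn) ab expr_mod.
have nz i : (c ^+ i)%g w != 0 by apply: cshiftX_neq0.
have inj := cshift_orbit_inj wfix.
have notin : 0 \notin [set (c ^+ i)%g w | i : 'I_n].
  by apply/imsetP => -[i _ /esym/eqP]; apply/negP.
have evalE : (map_poly intr (genfun X stat)).[z] = \sum_(x in X) z ^+ stat x.
  rewrite /genfun rmorph_sum horner_sum; apply: eq_bigr => x _.
  by rewrite /= map_polyXn hornerXn.
rewrite evalE XE big_setU1 //= stat0 expr0 big_imset /=; last first.
  by move=> i j _ _; apply: inj.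
have stati i : z ^+ stat ((c ^+ i)%g w) = z ^+ stat w * (z ^+ s) ^+ i.
  by rewrite (zmod _ _ (statc i)) exprD mulnC exprM.
under eq_bigr => i _ do rewrite stati.
have fixE x : x \in X -> (permz c d x == x) = (x == 0) || (n %| `|d|)%N.
  rewrite XE permz_cshift_fix => /setU1P[->|/imsetP[i _ ->]].
    by rewrite cshiftX0 !eqxx.
  rewrite (negbTE (nz i)) /= -permM -expgD addnC expgD permM.
  by rewrite (inj_eq (@perm_inj _ _)) wfix.
(* If [n] divides [d], then [z = 1] and all of [X] is fixed: both sides are [#|X|]. Otherwise the
   orbit contributes a vanishing geometric sum, and the 1 that remains counts the zero word, the
   only fixed point. *)
have [nd|nd] := boolP (n %| `|d|)%N.
  have /eqP-> : z == 1 by rewrite z1.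
  rewrite expr1n (eq_bigr (fun=> 1)) => [|i _]; last by rewrite !expr1n mulr1.
  rewrite sumr_const card_ord (_ : [set _ in _ | _] = X); last first.
    by apply/setP => x; rewrite inE -XE; case xX: (x \in X); rewrite //= fixE // nd orbT.
  by rewrite XE cardsU1 notin card_imset //= card_ord natrD.
rewrite -mulr_sumr geometric_root_sum ?mulr0 ?addr0; first last.
- apply: contra nd => /eqP zs; rewrite -z1.
  (* Bezout gives [a * n = b * s + 1], so [z ^+ s = 1] would force [z = 1]. *)
  have [a b e _] := egcdnP s npos; rewrite gcdnC (eqP cop) in e.
  have := congr1 (GRing.exp z) e.
  by rewrite exprD mulnC exprM zn expr1n mulnC exprM zs expr1n mul1r expr1 => <-.
- by rewrite -exprM mulnC exprM zn expr1n.
rewrite (_ : [set _ in _ | _] = [set 0]) ?cards1 //.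
apply/setP => x; rewrite -XE in_set1 inE; have [xX|xX] := boolP (x \in X).
  by rewrite fixE // (negbTE nd) orbF.
by apply/esym/negbTE; apply: contraNneq xX => ->; rewrite XE setU11.
Qed.

End Csp.

(** * Inversions and weight of binary words *)

Section BinaryInv.
Variables (F : finFieldType) (le : rel F) (n : nat).
Hypotheses (F2 : #|F| = 2%N) (hle : total_order le) (le01 : le 0 1).

Definition weight (u : 'rV[F]_n) : nat := #|[set i | u 0 i != 0]|.

Lemma weight_sum (u : 'rV[F]_n) :
  weight u = (\sum_(i < n) (u 0%R i != 0%R))%N.
Proof.
rewrite /weight -sum1dep_card big_mkcond.
by apply: eq_bigr => i _; case: (_ == _).
Qed.

(** A third element would contradict [F2], and antisymmetry excludes [le 1 0]. *)
Lemma gt_of_binary (x y : F) : gt_of le x y = (x != 0) && (y == 0).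
Proof.
have [[_ anti] _] := hle.
have nle10 : le 1 0 = false.
  apply/negP => le10; have := anti 0 1; rewrite le01 le10 => /(_ isT)/eqP.
  by rewrite eq_sym oner_eq0.
have F01 (z : F) : (z == 0) || (z == 1).
  apply/negPn/negP; rewrite negb_or => /andP[z0 z1].
  have /card_uniqP e : uniq [:: z; 0; 1].
    by rewrite /= !inE negb_or z0 z1 eq_sym oner_eq0.
  by have := max_card (mem [:: z; 0; 1]); rewrite e F2.
by rewrite /gt_of; case/orP: (F01 x) => /eqP->; case/orP: (F01 y) => /eqP->;
  rewrite ?eqxx ?oner_eq0 ?andbF ?le01 ?nle10 //= ?(eq_sym _ 1) ?oner_eq0.
Qed.

Lemma word_inv_sum (u : 'rV[F]_n) : word_inv le u =
  (\sum_(i < n) \sum_(j < n) [&& i < j, u 0%R i != 0%R & u 0%R j == 0%R])%N.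
Proof.
rewrite pair_big /= /word_inv -sum1dep_card big_mkcond /=.
by apply: eq_bigr => -[i j] _ /=; rewrite gt_of_binary; case: ifP.
Qed.

End BinaryInv.

(* Moving a leading 0 to the end creates one inversion with each nonzero
   letter; moving a leading 1 destroys one with each zero letter, and
   n - weight u is -weight u modulo n. *)
Lemma word_inv_cshift (F : finFieldType) (le : rel F) n (u : 'rV[F]_n) :
    #|F| = 2%N -> total_order le -> le 0 1 ->
  (word_inv le (cshift F n u) = word_inv le u + weight u %[mod n])%N.
Proof.
move=> F2 hle le01; rewrite !word_inv_sum // weight_sum.
case: n u => [|m] u; first by rewrite !big_ord0.
set c := cshift F m.+1.
have cw (i : 'I_m) : c u 0 (widen_ord (leqnSn m) i) = u 0 (lift ord0 i).
  by rewrite cshiftE; congr (u 0 _); apply: ord_inj; rewrite /= modn_small // ltnS.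
have cm : c u 0 ord_max = u 0 ord0.
  by rewrite cshiftE; congr (u 0 _); apply: ord_inj; rewrite /= modnn.
(* [T] counts the inversions inside the last [m] letters of [u] and [W] the nonzero letters there.
   This block occurs in both words, with the first letter of [u] before it or after it. *)
pose T := (\sum_(i < m) \sum_(j < m)
  [&& i < j, u 0%R (lift ord0 i) != 0%R & u 0%R (lift ord0 j) == 0%R])%N.
pose W := (\sum_(i < m) (u 0%R (lift ord0 i) != 0%R))%N.
have -> : (\sum_(i < m.+1) \sum_(j < m.+1)
    [&& i < j, c u 0%R i != 0%R & c u 0%R j == 0%R]
    = T + W * (u 0%R ord0 == 0%R))%N.
  rewrite big_ord_recr /= [X in (_ + X)%N]big1 => [|j _]; last first.
    by rewrite ltnNge -ltnS ltn_ord.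
  rewrite addn0 /T /W big_distrl -big_split /=; apply: eq_bigr => i _.
  rewrite big_ord_recr /= ltn_ord cw cm mulnb; congr (_ + _)%N.
  by apply: eq_bigr => j _; rewrite cw.
have -> : (\sum_(i < m.+1) \sum_(j < m.+1)
    [&& i < j, u 0%R i != 0%R & u 0%R j == 0%R]
    = (u 0%R ord0 != 0%R) * (m - W) + T)%N.
  rewrite big_ord_recl /= big_ord_recl /= add0n; congr (_ + _)%N.
    have -> : (m - W = \sum_(i < m) (u 0%R (lift ord0 i) == 0%R))%N.
      rewrite -[in (m - _)%N](card_ord m) -sum1_card.
      rewrite (eq_bigr (fun i => (u 0%R (lift ord0 i) == 0%R)
         + (u 0%R (lift ord0 i) != 0%R))%N) => [|i _]; last by case: eqP.
      by rewrite big_split addnK.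
    by rewrite big_distrr /=; apply: eq_bigr => j _; rewrite mulnb.
  by apply: eq_bigr => i _; rewrite big_ord_recl.
have Wm : (W <= m)%N.
  rewrite -[m in (_ <= m)%N]card_ord -sum1_card.
  by apply: leq_sum => i _; case: (_ == _).
rewrite big_ord_recl /= -/W; case: eqP => _ /=.
  by rewrite muln1 mul0n !add0n.
rewrite mul1n muln0 addn0.
have -> : (m - W + T + (1 + W) = m.+1 + T)%N by lia.
by rewrite modnDl.
Qed.

Lemma weight_cshift (F : finFieldType) n (u : 'rV[F]_n) :
  weight (cshift F n u) = weight u.
Proof.
rewrite /weight -[RHS](on_card_preimset (onW_bij _ (@ordS_bij n))).
by apply: eq_card => i; rewrite !inE !cshiftE.
Qed.

Lemma word_inv_cshiftX (F : finFieldType) (le : rel F) n (u : 'rV[F]_n) i :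
    #|F| = 2%N -> total_order le -> le 0 1 ->
  (word_inv le ((cshift F n ^+ i)%g u) = word_inv le u + i * weight u %[mod n])%N.
Proof.
move=> F2 hle le01; apply: stat_cshiftX => {}u; last exact: weight_cshift.
exact: word_inv_cshift.
Qed.

(** * Cyclic codes as ideals, through divisibility of polynomials *)

Lemma in_qpoly_monic_eq0 (K : fieldType) (h a : {poly K}) :
  h \is monic -> (1 < size h)%N -> (in_qpoly h a == 0) = (h %| a).
Proof.
by move=> hM sh; rewrite -val_eqE /= /mk_monic hM sh -Pdiv.IdomainMonic.modpE.
Qed.

Lemma qpoly_surj (K : nzRingType) (h : {poly K}) (a : {poly %/ h}) :
  in_qpoly h a = a.
Proof.
apply: val_inj; apply: in_qpoly_small.
by rewrite (leq_ltn_trans (size_npoly a)) // ltn_predL size_mk_monic_gt0.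
Qed.

Section CyclicCode.
Variables (F : finFieldType) (n : nat).
Hypothesis npos : (0 < n)%N.
Implicit Types (u v w : 'rV[F]_n) (p a b : {poly F}).

Let c := cshift F n.
Local Notation N := ('X^n - 1 : {poly F}).

Lemma XnB1_monic : N \is monic.
Proof. by rewrite -[1]polyC1 monicXnsubC. Qed.

Lemma size_XnB1 : size N = n.+1.
Proof. by rewrite -[1]polyC1 size_XnsubC. Qed.

Lemma XnB1_coprimeX : coprimep N 'X.
Proof.
by rewrite coprimepX /root !hornerE expr0n eqn0Ngt npos sub0r oppr_eq0 oner_eq0.
Qed.

Lemma XnB1_neq0 : N != 0.
Proof. exact/monic_neq0/XnB1_monic. Qed.

Lemma mem_cyclic_code p u : p %| N -> (u \in cyclic_code n p) = (p %| rVpoly u).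
Proof.
move=> pN; rewrite inE; apply/existsP/idP => [[a /eqP e]|/dvdpP[b e]].
  have : in_qpoly N (rVpoly u - (a : {poly F}) * p) == 0.
    by rewrite rmorphB rmorphM /= qpoly_surj e subrr.
  rewrite in_qpoly_monic_eq0 ?XnB1_monic ?size_XnB1 // => /(dvdp_trans pN).
  by rewrite dvdp_subl // dvdp_mull.
by exists (in_qpoly N b); rewrite e rmorphM.
Qed.

(** The left shift divides by x modulo [N]: the first letter passes from degree 0 to degree [n], and
    the difference is that letter times [N]. *)
Lemma rVpoly_cshift u : N %| 'X * rVpoly (c u) - rVpoly u.
Proof.
have -> : 'X * rVpoly (c u) - rVpoly u = u 0 (Ordinal npos) *: N.
  apply/polyP => i; rewrite coefB coefZ coefB coefXn coef1 coefXM !coef_rVpoly.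
  case: i => [|i] /=.
    rewrite insubT eq_sym eqn0Ngt npos /= !sub0r mulrN1.
    by congr (- u 0 _); apply: ord_inj.
  rewrite subr0; case: insubP => [j jn ji|] /=; last first.
    rewrite -leqNgt => ni; rewrite insubN -?leqNgt ?leqW //.
    by rewrite gtn_eqF ?mulr0 ?subr0.
  rewrite cshiftE; case: insubP => [l ln li|] /=.
    rewrite (ltn_eqF ln) mulr0 (_ : ordS j = l) ?subrr //.
    by apply: ord_inj; rewrite /= ji li modn_small.
  rewrite -leqNgt => ni; have -> : i.+1 = n by apply/eqP; rewrite eqn_leq jn ni.
  rewrite eqxx mulr1 subr0; congr (u 0 _); apply: ord_inj => /=.
  by rewrite ji (_ : i.+1 = n) ?modnn //; apply/eqP; rewrite eqn_leq jn ni.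
by rewrite -mul_polyC dvdp_mull.
Qed.

Lemma rVpoly_cshiftX m u : N %| 'X^m * rVpoly ((c ^+ m)%g u) - rVpoly u.
Proof.
elim: m u => [|m IH] u; first by rewrite perm1 mul1r subrr dvdp0.
rewrite expgS permM.
have -> : 'X^(m.+1) * rVpoly ((c ^+ m)%g (c u)) - rVpoly u
  = 'X * ('X^m * rVpoly ((c ^+ m)%g (c u)) - rVpoly (c u))
    + ('X * rVpoly (c u) - rVpoly u) by rewrite exprS; ring.
by rewrite dvdp_add ?rVpoly_cshift // dvdp_mull.
Qed.

(** As x is invertible modulo [N], multiplying the difference of the two words by a power of x loses
    nothing; words have degree below [n], so congruent ones are equal. *)
Lemma cshiftX_fix m u : ((c ^+ m)%g u == u) = (N %| ('X^m - 1) * rVpoly u).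
Proof.
have dvd := rVpoly_cshiftX m u; set v := (c ^+ m)%g u in dvd *.
apply/eqP/idP => [e|dN]; first by rewrite e in dvd; rewrite mulrBl mul1r.
have : N %| 'X^m * rVpoly (v - u).
  rewrite (_ : _ * _ = ('X^m * rVpoly v - rVpoly u) - ('X^m - 1) * rVpoly u).
    by rewrite dvdp_sub.
  by rewrite linearB /=; ring.
rewrite Gauss_dvdpr ?coprimep_expr ?XnB1_coprimeX // => dvu.
apply/eqP; rewrite -subr_eq0 -(inj_eq (can_inj rVpolyK)) linear0.
apply: contraLR dvu => nz; apply/negP => /(dvdp_leq nz).
by rewrite size_XnB1 leqNgt ltnS size_poly.
Qed.

Lemma cyclic_code_cshift p u : p %| N ->
  u \in cyclic_code n p -> c u \in cyclic_code n p.
Proof.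
move=> pN; rewrite !mem_cyclic_code // => pu.
have pX : coprimep p 'X by apply: coprimep_dvdr pN XnB1_coprimeX.
have := dvdp_trans pN (rVpoly_cshift u).
by rewrite dvdp_subl // Gauss_dvdpr.
Qed.

Lemma cyclic_codeB p u v : p %| N ->
  u \in cyclic_code n p -> v \in cyclic_code n p -> u - v \in cyclic_code n p.
Proof.
by move=> pN; rewrite !mem_cyclic_code // linearB => pu pv; apply: dvdp_sub.
Qed.

Lemma cyclic_code0 p : p %| N -> 0 \in cyclic_code n p.
Proof. by move=> pN; rewrite mem_cyclic_code // linear0 dvdp0. Qed.

(** * Encoding by the generator attached to a check polynomial [p] *)

Section CheckPolynomial.
Variables (k : nat) (p : {poly F}).
Hypotheses (pN : p %| N) (sp : size p = k.+1).

Let g := N %/ p.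

Lemma check_gen : g * p = N.
Proof. exact: divpK. Qed.

Lemma gen_dvd : g %| N.
Proof. by rewrite -check_gen dvdp_mulr. Qed.

Lemma check_neq0 : p != 0.
Proof. by rewrite -size_poly_eq0 sp. Qed.

Lemma gen_neq0 : g != 0.
Proof. by apply: contraNneq XnB1_neq0 => g0; rewrite -check_gen g0 mul0r. Qed.

Lemma size_gen : (size g + k = n.+1)%N.
Proof.
have := size_XnB1; rewrite -{1}check_gen size_mul ?gen_neq0 ?check_neq0 //.
by rewrite sp addnS.
Qed.

(** The constant terms of [g] and [p] multiply to -1. *)
Lemma gen_coef0 : g`_0 != 0.
Proof.
have : N`_0 = -1 by rewrite coefB coefXn coef1 eq_sym eqn0Ngt npos sub0r.
rewrite -check_gen coef0M => e; apply: contra_eq_neq e => ->.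
by rewrite mul0r eq_sym oppr_eq0 oner_eq0.
Qed.

(** For [size b <= k] the product fits into [n] letters; beyond that [poly_rV] may truncate it. *)
Definition encode b : 'rV[F]_n := poly_rV (b * g).

Lemma rVpoly_encode b : (size b <= k)%N -> rVpoly (encode b) = b * g.
Proof.
move=> sb; have [->|b0] := eqVneq b 0; first by rewrite /encode mul0r !linear0.
rewrite poly_rV_K // size_mul ?gen_neq0 //.
by rewrite -subn1 leq_subLR add1n -size_gen addnC leq_add2l.
Qed.

Lemma encode_in b : (size b <= k)%N -> encode b \in cyclic_code n g.
Proof.
by move=> sb; rewrite mem_cyclic_code ?gen_dvd // rVpoly_encode // dvdp_mull.
Qed.

Lemma cyclic_code_decode u : u \in cyclic_code n g ->
  exists2 b : {poly F}, (size b <= k)%N & u = encode b.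
Proof.
rewrite mem_cyclic_code ?gen_dvd // => /dvdpP[b e]; exists b; last first.
  by rewrite /encode -e rVpolyK.
have [->|b0] := eqVneq b 0; first by rewrite size_poly0.
have : (size (rVpoly u) <= n)%N by apply: size_poly.
rewrite e size_mul ?gen_neq0 //.
by rewrite -subn1 leq_subLR add1n -size_gen addnC leq_add2l.
Qed.

(** Multiplication by [g] is a bijection from the polynomials of degree below [k] onto the code. *)
Lemma card_cyclic_code : #|cyclic_code n g| = (#|F| ^ k)%N.
Proof.
have inj : injective (fun v : 'rV[F]_k => encode (rVpoly v)).
  move=> v w e; apply: (can_inj rVpolyK).
  apply: (mulIf gen_neq0); rewrite -!rVpoly_encode ?size_poly //.
  by rewrite e.
rewrite -[k in RHS]mul1n -card_mx -(card_imset _ inj); apply: eq_card => u.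
apply/idP/imsetP => [/cyclic_code_decode[b sb ->]|[v _ ->]].
  by exists (poly_rV b); rewrite ?poly_rV_K.
by rewrite encode_in // size_poly.
Qed.

(** Cancelling [g] from [N = g * p] turns periods of a codeword into divisibility by [p]. *)
Lemma encode_cshiftX_fix m b : (size b <= k)%N ->
  ((c ^+ m)%g (encode b) == encode b) = (p %| ('X^m - 1) * b).
Proof.
move=> sb; rewrite cshiftX_fix rVpoly_encode // -check_gen mulrA mulrC.
by rewrite dvdp_mul2r ?gen_neq0.
Qed.

(* g(0) <> 0, so the first two letters can be prescribed by the two lowest
   coefficients of the multiplier of g. *)
Lemma encode_first (i0 : 'I_n) (s t : F) : i0 = 0%N :> nat -> (0 < k)%N ->
  exists2 u, u \in cyclic_code n g &
    u 0 i0 = s /\ ((1 < k)%N -> (1 < n)%N -> u 0 (ordS i0) = t).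
Proof.
(* This solves the triangular system [s = b0 * g_0], [t = b0 * g_1 + b1 * g_0]. For [k = 1] only
   constant multipliers are allowed. *)
move=> i00 k0; pose b0 := s / g`_0; pose b1 := (t - b0 * g`_1) / g`_0.
pose b := if (1 < k)%N then b0%:P + b1 *: 'X else b0%:P.
have sb : (size b <= k)%N.
  rewrite /b; case: ifP => k1; last exact: leq_trans (size_polyC_leq1 _) k0.
  rewrite (leq_trans (size_polyD _ _)) // geq_max.
  rewrite (leq_trans (size_polyC_leq1 _)) //.
  by rewrite (leq_trans (size_scale_leq _ _)) // size_polyX.
have b0E : b`_0 = b0.
  by rewrite /b; case: ifP; rewrite ?coefD ?coefZ coefC ?coefX /= ?mulr0 ?addr0.
exists (encode b); first exact: encode_in.
rewrite !mxE i00; split=> [|k1 n1].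
  by rewrite coef0M b0E mulfVK ?gen_coef0.
rewrite /= i00 modn_small //.
rewrite /b k1 mulrDl coefD coefCM -scalerAl coefZ coefXM /=.
by rewrite /b1 mulfVK ?gen_coef0 // addrC subrK.
Qed.

End CheckPolynomial.
End CyclicCode.

(* The fibres of a linear map that is onto V already on C are the cosets of
   its kernel in C, so they all have #|C| / #|V| elements. *)
Lemma card_additive_preimage (U : finZmodType) (V : finType) (C : {set U}) (f : U -> V)
    (Q : pred V) :
    (forall u v, (f u == f v) = (f (u - v) == f 0)) -> {in C &, forall u v, u - v \in C} ->
    (forall y, exists2 u, u \in C & f u = y) ->
  (#|[set u in C | Q (f u)]| * #|V| = #|Q| * #|C|)%N.
Proof.
move=> fB CB fsurj; pose K := #|[set u in C | f u == f 0]|.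
have C0 : 0 \in C by have [u uC _] := fsurj (f 0); rewrite -(subrr u) CB.
have CD u v : u \in C -> v \in C -> u + v \in C.
  by move=> uC vC; rewrite -[v]opprK CB // -sub0r CB.
have fibre y : #|[set u in C | f u == y]| = K.
  have [v vC fv] := fsurj y.
  rewrite /K -(card_imset _ (addIr (- v))); apply: eq_card => x.
  apply/imsetP/idP => [[u]|]; rewrite !inE.
    by rewrite -fv fB => /andP[uC fu] ->; rewrite CB.
  move=> /andP[xC /eqP fx]; exists (x + v); last by rewrite addrK.
  by rewrite inE CD //= -fv fB addrK fx.
have cnt (P : pred V) : #|[set u in C | P (f u)]| = (#|P| * K)%N.
  rewrite -sum1dep_card (partition_big f P) /= => [|u /andP[]//].
  rewrite -sum_nat_const; apply: eq_bigr => y Py.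
  rewrite -(fibre y) -sum1dep_card; apply: eq_bigl => u.
  by case: eqP => [->|]; rewrite ?Py ?andbT ?andbF.
(* The total count [#|C| = #|V| * K] eliminates [K]. *)
have := cnt predT; rewrite (_ : [set u in C | _] = C) => [->|]; last first.
  by apply/setP => u; rewrite inE andbT.
by rewrite cnt -mulnA [(K * _)%N]mulnC.
Qed.

(** Swapping coordinates exchanges the pairs that descend with those that ascend; the diagonal
    accounts for the rest. *)
Lemma card_gt_of (F : finFieldType) (le : rel F) : total_order le ->
  (#|(fun z : F * F => gt_of le z.1 z.2)| * 2 = #|F| * (#|F| - 1))%N.
Proof.
move=> [[_ anti] tot]; set G := #|_|.
have GE : G = (\sum_(z : F * F) gt_of le z.1 z.2)%N.
  rewrite /G -sum1_card big_mkcond; apply: eq_bigr => z _.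
  by rewrite unfold_in; case: gt_of.
have GE' : G = (\sum_(z : F * F) gt_of le z.2 z.1)%N.
  have swapK : involutive (fun z : F * F => (z.2, z.1)) by case.
  by rewrite GE (reindex_inj (inv_inj swapK)).
have DE : (\sum_(z : F * F) (z.1 == z.2))%N = #|F|.
  rewrite -(pair_big xpredT xpredT (fun x y : F => (x == y) : nat)) /=.
  rewrite -sum1_card; apply: eq_bigr => x _.
  by rewrite (bigD1 x) //= eqxx big1 // => y /negbTE; rewrite eq_sym => ->.
have : (#|{: F * F}| = G + G + #|F|)%N.
  rewrite -DE {1}GE GE' -!big_split -sum1_card /=.
  apply: eq_bigr => -[x y] _ /=; rewrite /gt_of (eq_sym y x).
  have [<-|xy] := eqVneq x y; first by rewrite !andbF.
  rewrite !andbT; have := tot x y; have := anti x y.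
  case: (le x y); case: (le y x) => //= /(_ isT) e.
  by rewrite e eqxx in xy.
rewrite card_prod mulnBr muln1 muln2 -addnn => ->.
by rewrite addnK.
Qed.

(** Covers [k = 1], [q = 3], where one letter determines the codeword and the first two letters
    cannot be prescribed independently. *)
Lemma word_cdes_2 (F : finFieldType) (le : rel F) n (w : 'rV[F]_n) :
  total_order le -> n = 2%N -> cshift F n w != w -> word_cdes le w = 1%N.
Proof.
move=> [[_ anti] tot] n2; move: w; rewrite n2 => w wfix.
have o1 : ordS (ord0 : 'I_2) = lift ord0 ord0 by apply: ord_inj.
have o0 : ordS (lift ord0 ord0 : 'I_2) = ord0 by apply: ord_inj.
rewrite /word_cdes -sum1dep_card big_mkcond !big_ord_recl big_ord0 o0 o1.
set x := w 0 _; set y := w 0 _.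
have xy : x != y.
  apply: contraNneq wfix => e; apply/eqP/rowP => i; rewrite cshiftE.
  case: (unliftP ord0 i) => [j|] ->; last by rewrite o1 -/y -e.
  by rewrite ord1 o0 -/x e.
rewrite /gt_of (eq_sym y) xy !andbT; have := tot x y; have := anti x y.
case: (le x y); case: (le y x) => //= /(_ isT) e.
by rewrite e eqxx in xy.
Qed.

(* The simplex codes are the dual Hamming codes. *)
Section Simplex.
Variables (F : finFieldType) (k : nat) (p : {poly F}).
Hypotheses (k0 : (0 < k)%N) (pprim : primitive_poly p) (sp : size p = k.+1).

Let n := (#|F| ^ k - 1)%N.
Let c := cshift F n.
Local Notation N := ('X^n - 1 : {poly F}).
Let g : {poly F} := N %/ p.
Let C := cyclic_code n g.

Lemma simplex_length_gt0 : (0 < n)%N.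
Proof. by rewrite subn_gt0 -(exp1n k) ltn_exp2r // finNzRing_gt1. Qed.

Lemma primitive_dvd m : (p %| 'X^m - 1) = (n %| m)%N.
Proof.
have /primitive_poly_orderP[pM pI] := pprim; rewrite sp /= -/n => pr.
rewrite (prim_order_dvd pr) -in_qpoly_monic_eq0 ?sp //.
by rewrite rmorphB rmorphXn rmorph1 subr_eq0.
Qed.

Let npos := simplex_length_gt0.

Let cardF_gt0 : (0 < #|F|)%N.
Proof. exact: ltn_trans (finNzRing_gt1 F). Qed.

Lemma primitive_dvd_XnB1 : p %| N.
Proof. by rewrite primitive_dvd. Qed.

Let pN := primitive_dvd_XnB1.

(** The multiplier of a nonzero codeword has degree below [k], so it is prime to the irreducible [p]
    and cancels, leaving the order of x modulo [p]. *)
Lemma simplex_cshiftX_fix w m : w \in C -> w != 0 ->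
  ((c ^+ m)%g w == w) = (n %| m)%N.
Proof.
have /primitive_poly_orderP[pM pI _] := pprim.
move=> /(cyclic_code_decode npos pN sp)[b sb ->] w0.
rewrite (encode_cshiftX_fix npos pN sp) // -primitive_dvd Gauss_dvdpl //.
have b0 : b != 0 by apply: contraNneq w0 => ->; rewrite /encode mul0r linear0.
rewrite irreducible_poly_coprime //; apply/negP => /(dvdp_leq b0).
by rewrite sp leqNgt ltnS sb.
Qed.

(** The shifts of [w] and 0 are [n + 1 = #|F| ^ k] distinct codewords, which is the size of the
    code. *)
Lemma simplex_orbit w : w \in C -> w != 0 ->
  C = 0 |: [set (c ^+ i)%g w | i : 'I_n].
Proof.
move=> wC w0; have wfix m := simplex_cshiftX_fix m wC w0.
apply/esym/eqP; rewrite eqEcard; apply/andP; split.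
  apply/subsetP => x /setU1P[->|/imsetP[i _ ->]].
    by rewrite cyclic_code0 // gen_dvd.
  elim: (i : nat) => [|j IH]; first by rewrite perm1.
  by rewrite expgSr permM cyclic_code_cshift // gen_dvd.
rewrite (card_cyclic_code npos pN sp) cardsU1.
rewrite card_imset ?card_ord; last exact: cshift_orbit_inj.
have -> : 0 \notin [set (c ^+ i)%g w | i : 'I_n].
  by apply/imsetP => -[i _ /esym/eqP]; apply/negP/cshiftX_neq0.
by rewrite /n subnKC // expn_gt0 (ltn_trans _ (finNzRing_gt1 F)).
Qed.

Lemma simplexB : {in C &, forall u v, u - v \in C}.
Proof. by move=> u v; apply: cyclic_codeB; rewrite ?gen_dvd. Qed.

(* The letters of w, in order, are the first letters of the nonzero
   codewords. *)
Lemma simplex_count w (Q : rel F) (i0 : 'I_n) : i0 = 0%N :> nat ->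
    w \in C -> w != 0 -> Q 0 0 = false ->
  #|[set i | Q (w 0 i) (w 0 (ordS i))]|
    = #|[set u in C | Q (u 0 i0) (u 0 (ordS i0))]|.
Proof.
move=> i00 wC w0 Q0; have wfix m := simplex_cshiftX_fix m wC w0.
rewrite -(card_imset _ (cshift_orbit_inj wfix)); apply: eq_card => u.
(* Shifting by [j] brings the letter [j] and its cyclic successor to the front. *)
have letter (j : 'I_n) : ((c ^+ j)%g w 0 i0 = w 0 j) *
    ((c ^+ j)%g w 0 (ordS i0) = w 0 (ordS j)).
  by rewrite !cshiftXE -iterSr iterS iter_ordS0.
rewrite [in RHS]inE [in X in _ = X && _](simplex_orbit wC w0).
apply/imsetP/andP => [[j]|[/setU1P[->|/imsetP[j _ ->]]]].
- by rewrite inE => Qj ->; rewrite !letter setU1r // imset_f.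
- by rewrite !mxE Q0.
- by rewrite !letter => Qj; exists j; rewrite ?inE.
Qed.

Lemma simplex_weight w : w \in C -> w != 0 ->
  weight w = ((#|F| - 1) * #|F| ^ (k - 1))%N.
Proof.
move=> wC w0; pose i0 : 'I_n := Ordinal npos.
have i00 : i0 = 0%N :> nat by [].
rewrite /weight (simplex_count (Q := fun x _ => x != 0) i00) ?eqxx //.
have fsurj y : exists2 u, u \in C & u 0 i0 = y.
  by have [u uC [uy _]] := encode_first npos pN sp y 0 i00 k0; exists u.
have := card_additive_preimage (fun x => x != 0) (fun u v => _) simplexB fsurj.
rewrite (card_cyclic_code npos pN sp) -/C.
have -> : #|(fun x : F => x != 0)| = (#|F| - 1)%N.
  by rewrite -(cardC (pred1 (0 : F))) card1 addKn.
have -> : (#|F| ^ k = #|F| ^ (k - 1) * #|F|)%N by rewrite -expnSr subn1 prednK.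
rewrite mulnA => e; apply/eqP; rewrite -(eqn_pmul2r cardF_gt0); apply/eqP/e.
by move=> u v; rewrite !mxE subr_eq0.
Qed.

(** For [k > 1] the first two letters are evenly distributed over all pairs, half of whose
    off-diagonal part descends. The count is doubled to stay in the naturals. *)
Lemma simplex_cdes (le : rel F) w : total_order le -> (1 < k)%N \/ #|F| = 3%N ->
  w \in C -> w != 0 ->
  (word_cdes le w * 2 = (#|F| - 1) * #|F| ^ (k - 1))%N.
Proof.
move=> hle hk wC w0; have F1 := finNzRing_gt1 F.
have [k1|k1] := ltnP 1 k; last first.
  have {hk}F3 : #|F| = 3%N by case: hk => // hk; have := leq_trans hk k1; rewrite ltnn.
  have ke : k = 1%N by apply/eqP; rewrite eqn_leq k1 k0.
  have n2 : n = 2%N by rewrite /n F3 ke.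
  rewrite (word_cdes_2 hle n2) ?F3 ?ke //.
  by rewrite -[cshift _ _]/(c ^+ 1)%g simplex_cshiftX_fix // n2.
have n1 : (1 < n)%N.
  rewrite /n ltn_subRL addn1; apply: (@leq_trans (2 ^ 2)%N) => //.
  by rewrite (leq_trans (leq_pexp2l _ k1)) // leq_exp2r.
pose i0 : 'I_n := Ordinal npos.
have i00 : i0 = 0%N :> nat by [].
pose f (u : 'rV[F]_n) := (u 0 i0, u 0 (ordS i0)).
have fsurj y : exists2 u, u \in C & f u = y.
  have [u uC [u0 /(_ k1 n1) u1]] := encode_first npos pN sp y.1 y.2 i00 k0.
  by exists u; rewrite // /f u0 u1 -surjective_pairing.
have fB u v : (f u == f v) = (f (u - v) == f 0).
  by rewrite /f !mxE !xpair_eqE !subr_eq0.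
have := card_additive_preimage (fun z => gt_of le z.1 z.2) fB simplexB fsurj.
rewrite -(simplex_count (Q := gt_of le) i00 wC w0); last first.
  by rewrite /gt_of eqxx andbF.
rewrite (card_cyclic_code npos pN sp) card_prod -/(word_cdes le w) => e.
have {}e := congr1 (muln^~ 2) e.
have ek : (#|F| ^ k = #|F| ^ (k - 1) * #|F|)%N by rewrite -expnSr subn1 prednK.
rewrite /= mulnAC [in RHS]mulnAC card_gt_of // ek in e.
apply/eqP; rewrite -(eqn_pmul2r cardF_gt0) -(eqn_pmul2r cardF_gt0); apply/eqP.
by rewrite -mulnA e; ring.
Qed.

End Simplex.

(** * The zero word, coprimality to [n], and the four claims *)

Lemma word_maj0 (F : finFieldType) (le : rel F) n :
  word_maj le (0 : 'rV[F]_n) = 0%N.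
Proof. by apply: big_pred0 => i; rewrite !mxE /gt_of eqxx !andbF. Qed.

Lemma word_inv0 (F : finFieldType) (le : rel F) n :
  word_inv le (0 : 'rV[F]_n) = 0%N.
Proof. by apply: eq_card0 => i; rewrite inE !mxE /gt_of eqxx !andbF. Qed.

Lemma coprime_expn_sub1 q k : (0 < q)%N -> (0 < k)%N -> coprime q (q ^ k - 1).
Proof.
move=> q0 k0; apply: (@coprime_dvdl _ (q ^ k)); first by rewrite dvdn_exp.
by rewrite -{1}(subnK (_ : 0 < q ^ k)%N) ?expn_gt0 ?q0 // addn1 coprimeSn.
Qed.

(** For both values of [q], [c] divides a power of [q], and [q] is prime to [q ^ k - 1]. *)
Lemma simplex_cdes_coprime q k c : q = 2%N \/ q = 3%N -> (0 < k)%N ->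
  (c * 2 = (q - 1) * q ^ (k - 1))%N -> coprime c (q ^ k - 1).
Proof.
move=> hq k0 e; have q0 : (0 < q)%N by case: hq => ->.
apply: (@coprime_dvdl _ (q ^ (k - 1))); last first.
  by rewrite coprimeXl // coprime_expn_sub1.
case: hq e => ->; first by rewrite mul1n => <-; rewrite dvdn_mulr.
by rewrite mulnC => /eqP; rewrite eqn_mul2l /= => /eqP->.
Qed.

Lemma cdes_ratE (q k c : nat) : (0 < q)%N ->
  (c * 2 = (q - 1) * q ^ (k - 1))%N <->
  c%:R = (q%:R - 1) / 2 * q%:R ^+ (k - 1) :> rat.
Proof.
move=> q0; have two0 : 2%:R != 0 :> rat by [].
split=> e.
  apply: (mulIf two0); rewrite mulrAC mulfVK // -(natrB _ q0) -natrX -!natrM.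
  by rewrite e.
apply/eqP; rewrite -(eqr_nat rat) !natrM natrB // natrX e.
by rewrite mulrAC mulfVK.
Qed.

Theorem theorem4p5 (R : realType) (k q n : nat) (F : finFieldType)
    (le : rel F) (hk : (0 < k)%N) (hq : #|F| = q) (hn : n = (q ^ k - 1)%N)
    (hle : total_order le) :
  [/\ (* (i) *)
      ((1 < k)%N \/ q = 3%N) ->
      forall C : {set 'rV[F]_n}, dual_hamming_code k C ->
      forall w : 'rV[F]_n, w \in C -> w != 0 ->
        (word_cdes le w)%:R = (q%:R - 1) / 2 * q%:R ^+ (k - 1) :> rat,
      (* (ii) *)
      ((1 < k)%N \/ q = 3%N) ->
      q = 2%N \/ q = 3%N ->
      forall gperp : {poly F},
        gperp \is monic -> irreducible_poly gperp -> size gperp = k.+1 ->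
        gperp %| 'X^n - 1 ->
        (primitive_poly gperp <->
         (word_cdes le (poly_rV (('X^n - 1) %/ gperp) : 'rV[F]_n))%:R
           = (q%:R - 1) / 2 * q%:R ^+ (k - 1) :> rat),
      (* (iii) *)
      q = 2%N \/ q = 3%N ->
      forall C : {set 'rV[F]_n}, dual_hamming_code k C ->
        exhibits_csp R C (genfun C (word_maj le)) (cshift F n) n
    & (* (iv) *)
      q = 2%N -> le 0 1 ->
      forall C : {set 'rV[F]_n}, dual_hamming_code k C ->
        exhibits_csp R C (genfun C (word_inv le)) (cshift F n) n].
Proof.
subst q n; set n := (_ - 1)%N.
have npos : (0 < n)%N := simplex_length_gt0 F hk.
have F0 : (0 < #|F|)%N := ltn_trans (ltn0Sn 0) (finNzRing_gt1 F).
(* The word of [g] is the encoding of 1; it supplies a nonzero codeword in each claim. *)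
have genw (p : {poly F}) : size p = k.+1 -> p %| 'X^n - 1 ->
    encode n p 1 \in cyclic_code n (('X^n - 1) %/ p) /\ encode n p 1 != 0.
  move=> sp pN; have s1 : (size (1%R : {poly F}) <= k)%N by rewrite size_poly1.
  split; first exact: (encode_in npos pN sp s1).
  apply: contraNneq (gen_neq0 npos pN) => e.
  by rewrite -[_ %/ _]mul1r -(rVpoly_encode npos pN sp s1) e linear0.
split.
- move=> hk1 C [_ [p [pp sp ->]]] w wC w0.
  exact/cdes_ratE/(simplex_cdes hk pp sp hle hk1 wC w0).
- move=> hk1 hq p pM pI sp pN; have [wC w0] := genw p sp pN.
  rewrite (_ : poly_rV _ = encode n p 1); last by rewrite /encode mul1r.
  split=> [pp|/(cdes_ratE _ _ F0) e].
    exact/cdes_ratE/(simplex_cdes hk pp sp hle hk1 wC w0).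
  have cop := simplex_cdes_coprime hq hk e.
  apply/primitive_polyP => /=; rewrite card_monic_qpoly ?sp // -subn1 /=.
  split=> // m /andP[m0 mn]; apply: contraL mn => pm; rewrite -leqNgt.
  apply: dvdn_leq => //.
  have /eqP fix_m : (cshift F n ^+ m)%g (encode n p 1) == encode n p 1.
    by rewrite (encode_cshiftX_fix npos pN sp) ?size_poly1 // mulr1.
  have /esym/eqP := word_maj_cshiftX le (encode n p 1) m npos.
  (* Unchanged maj means that [n] divides [m] times [n.-1] times cdes; the last two factors are
     prime to [n]. *)
  rewrite fix_m -[X in _ == X %[mod _]]addn0 eqn_modDl mod0n -/(_ %| _)%N.
  rewrite Gauss_dvdl // coprime_sym coprimeMl cop andbT.
  by rewrite -{2}(prednK npos) coprimenS.
- move=> hq C [_ [p [pp sp ->]]].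
  have pN : p %| 'X^n - 1 by rewrite primitive_dvd_XnB1.
  have [wC w0] := genw p sp pN.
  refine (orbit_exhibits_csp (stat := word_maj le) (s := (n.-1 * word_cdes le (encode n p 1))%N)
    R npos w0 _ (simplex_orbit hk pp sp wC w0) _ _ _).
  + by move=> m; apply: (simplex_cshiftX_fix hk pp sp).
  + exact: word_maj0.
  + by move=> i; apply: word_maj_cshiftX.
  rewrite coprimeMl -{2}(prednK npos) coprimenS /=.
  (* [n = 1] is the case [k = 1], [q = 2], where the cdes formula fails but coprimality to 1 is
     automatic. *)
  have [n1|n1] := eqVneq n 1%N; first by rewrite n1 coprimen1.
  apply: (simplex_cdes_coprime hq hk).
  apply: (simplex_cdes hk pp sp hle _ wC w0).
  case: hq => hq; last by right.
  left; rewrite ltn_neqAle hk andbT; apply: contraNneq n1 => k1.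
  by rewrite /n -k1 hq.
- move=> hq le01 C [_ [p [pp sp ->]]].
  have pN : p %| 'X^n - 1 by rewrite primitive_dvd_XnB1.
  have [wC w0] := genw p sp pN.
  refine (orbit_exhibits_csp (stat := word_inv le) (s := (weight (encode n p 1))%N)
    R npos w0 _ (simplex_orbit hk pp sp wC w0) _ _ _).
  + by move=> m; apply: (simplex_cshiftX_fix hk pp sp).
  + exact: word_inv0.
  + by move=> i; apply: word_inv_cshiftX.
  rewrite (simplex_weight hk pp sp wC w0) hq mul1n /n hq.
  by rewrite coprimeXl // coprime_expn_sub1.
Qed.
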